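(* Let $b_{gt}=[z_0^{gt},z_1^{gt},z_2^{gt},z_3^{gt}]\in\mathcal{B}$ be a ground-truth bounding box with $a(b_{gt})>0$. For $i=0,1,2,3$ let $[\underline{z_i},\overline{z_i}]\subset\mathbb{R}_{+}$ be a nonempty closed interval, and assume $\underline{z_0}\le\underline{z_2}$, $\overline{z_0}\le\overline{z_2}$, $\underline{z_1}\le\underline{z_3}$, $\overline{z_1}\le\overline{z_3}$. Let $[\underline{\mathbf b},\overline{\mathbf b}]=\{[z_0,z_1,z_2,z_3]\in\mathcal{B} : \underline{z_i}\le z_i\le\overline{z_i},\ i=0,\dots,3\}$, and let $V=\prod_{i=0}^{3}\{\underline{z_i},\overline{z_i}\}$ be the set of (at most 16) vertices of $\prod_{i=0}^3[\underline{z_i},\overline{z_i}]$. Then $$\min_{b\in[\underline{\mathbf b},\overline{\mathbf b}]} IoU_{gt}(b)=\begin{cases} 0 & \text{if } \underline{z_2}\le\overline{z_0}\ \text{ or }\ \underline{z_3}\le\overline{z_1},\\[2pt] \displaystyle\min_{b\in V} IoU_{gt}(b) & \text{otherwise.}\end{cases}$$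
   Context: The set of bounding boxes is $\mathcal{B}=\{[z_0,z_1,z_2,z_3]\in\mathbb{R}_{+}^4 : z_0\le z_2,\ z_1\le z_3\}$, where $\mathbb{R}_{+}=[0,\infty)$; $(z_0,z_1)$ is the bottom-left corner and $(z_2,z_3)$ the upper-right corner. The area of a box $b=[z_0,z_1,z_2,z_3]\in\mathcal{B}$ is $a(b)=(z_2-z_0)(z_3-z_1)$. The intersection of $b$ with the ground truth $b_{gt}$ is $$i_{gt}(b)=\big[\max(z_0,z_0^{gt}),\max(z_1,z_1^{gt}),\min(z_2,z_2^{gt}),\min(z_3,z_3^{gt})\big],$$ and its area $a(i_{gt}(b))$ is given by the same formula when $i_{gt}(b)\in\mathcal{B}$ and is taken to be $0$ when $i_{gt}(b)\notin\mathcal{B}$ (the boxes do not overlap). The Intersection over Union is $$IoU_{gt}(b)=\frac{a(i_{gt}(b))}{a(b_{gt})+a(b)-a(i_{gt}(b))}\in[0,1].$$ In the ''otherwise'' case every element of $V$ belongs to $\mathcal{B}$. *)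

(* Defs.v *)
From HB Require Import structures.
From mathcomp Require Import all_boot all_order all_algebra.
From mathcomp Require Import boolp classical_sets reals.

Set Implicit Arguments.
Unset Strict Implicit.
Unset Printing Implicit Defensive.

Import Order.TTheory GRing.Theory Num.Theory.
Local Open Scope classical_set_scope.
Local Open Scope ring_scope.

(* A point [z_0, z_1, z_2, z_3] of R^4 is a row vector b, with z_i = b 0 i.
   The column indices 0, 1, 2, 3 are elements of the ring 'I_4 = Z/4, so that
   they denote four distinct ordinals with the expected values. *)

Definition is_box (R : realType) (b : 'rV[R]_4) : bool :=
  [&& [forall i, 0 <= b 0 i], b 0 0 <= b 0 2 & b 0 1 <= b 0 3].

(* Only meaningful when b is a box. *)
Definition area (R : realType) (b : 'rV[R]_4) : R :=
  (b 0 2 - b 0 0) * (b 0 3 - b 0 1).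

(* The corners of the intersection; this is a box only if g and b overlap. *)
Definition inter (R : realType) (g b : 'rV[R]_4) : 'rV[R]_4 :=
  \row_(i < 4) if (i < 2)%N then Num.max (b 0 i) (g 0 i)
               else Num.min (b 0 i) (g 0 i).

Definition inter_area (R : realType) (g b : 'rV[R]_4) : R :=
  if is_box (inter g b) then area (inter g b) else 0.

Definition IoU (R : realType) (g b : 'rV[R]_4) : R :=
  inter_area g b / (area g + area b - inter_area g b).

Definition box_range (R : realType) (zl zu : 'rV[R]_4) : set 'rV[R]_4 :=
  [set b | is_box b /\ forall i, zl 0 i <= b 0 i <= zu 0 i].

Definition vertices (R : realType) (zl zu : 'rV[R]_4) : set 'rV[R]_4 :=
  [set b | forall i, b 0 i = zl 0 i \/ b 0 i = zu 0 i].

(* m is the minimum, attained, of f over S. *)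
Definition is_min (T : Type) (R : realType) (S : set T) (f : T -> R) (m : R) :=
  (f @` S) m /\ lbound (f @` S) m.

(* IoU is a total function on R^4; when the second case of the minimum formula
   applies, it is only evaluated at boxes. *)
Lemma vertices_box (R : realType) (zl zu : 'rV[R]_4) :
  (forall i, 0 <= zl 0 i <= zu 0 i) ->
  ~ (zl 0 2 <= zu 0 0 \/ zl 0 3 <= zu 0 1) ->
  vertices zl zu `<=` [set b | is_box b].
Proof.
move=> zlu ndeg b Vb.
have blu i : zl 0 i <= b 0 i <= zu 0 i.
  by have /andP[? lu] := zlu i; case: (Vb i) => ->; rewrite lexx ?lu.
have lt02 : zu 0 0 < zl 0 2 by rewrite ltNge; apply/negP => ?; apply: ndeg; left.
have lt13 : zu 0 1 < zl 0 3 by rewrite ltNge; apply/negP => ?; apply: ndeg; right.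
have mid i j : zu 0 i < zl 0 j -> b 0 i <= b 0 j.
  have /andP[_ bi] := blu i; have /andP[bj _] := blu j.
  by move=> /ltW ij; apply: le_trans bi (le_trans ij bj).
apply/and3P; split; [apply/forallP => i | exact: mid | exact: mid].
by have /andP[l0 _] := zlu i; have /andP[lb _] := blu i; apply: le_trans l0 lb.
Qed.

(* Main.v *)
Require Import Defs.
From HB Require Import structures.
From mathcomp Require Import all_boot all_order all_algebra.
From mathcomp Require Import boolp classical_sets reals.
From mathcomp Require Import ring lra.

Set Implicit Arguments.
Unset Strict Implicit.
Unset Printing Implicit Defensive.

Import Order.TTheory GRing.Theory Num.Theory.
Local Open Scope classical_set_scope.
Local Open Scope ring_scope.

(** On boxes the intersection area is the product of the lengths of overlap of
    the two sides.  With the vertical side fixed, and as long as the overlap is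
    positive, [c < IoU] is a linear inequality between the box width and the
    length of overlap, and the latter is a concave function of the horizontal
    side; hence the IoU is quasi-concave in that side.  So each coordinate in
    turn can be moved to an end of its interval without increasing the IoU.  In
    the degenerate case the range contains a flat box. *)

(** * One side of a box at a time *)

Definition overlap (R : realType) (c d a b : R) : R :=
  Num.max 0 (Num.min b d - Num.max a c).

(** The IoU seen from the side [[a, b]] of the box: [[c, d]] is the matching side of the ground
    truth, [G] the ground-truth area, [h] the length of the other side of the box and [q] its
    overlap. *)
Definition iou_side (R : realType) (G c d q h a b : R) : R :=
  overlap c d a b * q / (G + (b - a) * h - overlap c d a b * q).

Lemma overlap_ge0 (R : realType) (c d a b : R) : 0 <= overlap c d a b.
Proof. by rewrite /overlap le_max lexx. Qed.

Lemma overlap_le (R : realType) (c d a b : R) : a <= b -> overlap c d a b <= b - a.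
Proof.
by move=> ab; rewrite /overlap ge_max subr_ge0 ab lerB // ?ge_min ?le_max lexx.
Qed.

Lemma overlap_bounds (R : realType) (c d a b : R) : a <= b -> 0 <= overlap c d a b <= b - a.
Proof. by move=> ab; rewrite overlap_ge0 overlap_le. Qed.

(** A minimum is concave and a maximum convex. Truncation at 0 breaks concavity in general, hence
    the positivity required at both ends. *)
Lemma overlap_concave (R : realType) (c d a1 b1 a2 b2 t : R) :
  0 <= t <= 1 -> 0 < overlap c d a1 b1 -> 0 < overlap c d a2 b2 ->
  (1 - t) * overlap c d a1 b1 + t * overlap c d a2 b2 <=
    overlap c d ((1 - t) * a1 + t * a2) ((1 - t) * b1 + t * b2).
Proof.
rewrite /overlap => /andP[t0 t1]; rewrite !lt_max ltxx /= => p1 p2.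
rewrite le_max (max_r (ltW p1)) (max_r (ltW p2)); apply/orP; right.
have mb1 : Num.min b1 d <= b1 by rewrite ge_min lexx.
have md1 : Num.min b1 d <= d by rewrite ge_min lexx orbT.
have mb2 : Num.min b2 d <= b2 by rewrite ge_min lexx.
have md2 : Num.min b2 d <= d by rewrite ge_min lexx orbT.
have Ma1 : a1 <= Num.max a1 c by rewrite le_max lexx.
have Mc1 : c <= Num.max a1 c by rewrite le_max lexx orbT.
have Ma2 : a2 <= Num.max a2 c by rewrite le_max lexx.
have Mc2 : c <= Num.max a2 c by rewrite le_max lexx orbT.
have minP : (1 - t) * Num.min b1 d + t * Num.min b2 d <=
    Num.min ((1 - t) * b1 + t * b2) d by rewrite le_min; apply/andP; split; nra.
have maxP : Num.max ((1 - t) * a1 + t * a2) c <=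
    (1 - t) * Num.max a1 c + t * Num.max a2 c.
  by rewrite ge_max; apply/andP; split; nra.
by lra.
Qed.

Lemma iou_side_den_gt0 (R : realType) (G c d q h a b : R) :
  0 < G -> 0 <= q <= h -> a <= b ->
  0 < G + (b - a) * h - overlap c d a b * q.
Proof.
move=> G0 /andP[q0 qh] ab.
have := ler_pM (overlap_ge0 c d a b) q0 (overlap_le c d ab) qh; lra.
Qed.

Lemma iou_side_ge0 (R : realType) (G c d q h a b : R) :
  0 < G -> 0 <= q <= h -> a <= b -> 0 <= iou_side G c d q h a b.
Proof.
move=> G0 qh ab; have /andP[q0 _] := qh.
by rewrite divr_ge0 ?mulr_ge0 ?overlap_ge0 // ltW // iou_side_den_gt0.
Qed.

Lemma iou_side_quasiconcave (R : realType) (G c d q h a1 b1 a2 b2 t : R) :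
  0 < G -> 0 <= q <= h -> a1 <= b1 -> a2 <= b2 -> 0 <= t <= 1 ->
  let K := iou_side G c d q h in
  let m := K ((1 - t) * a1 + t * a2) ((1 - t) * b1 + t * b2) in
  K a1 b1 <= m \/ K a2 b2 <= m.
Proof.
move=> G0 qh ab1 ab2 t01 K m.
set a := (1 - t) * a1 + t * a2; set b := (1 - t) * b1 + t * b2.
have /andP[t0 t1] := t01; have /andP[q0 _] := qh.
have ab : a <= b by rewrite /a /b; nra.
have m0 : 0 <= m by exact: iou_side_ge0.
have gt_m u v : u <= v ->
    m < K u v -> 0 < overlap c d u v /\
      m * (G + (v - u) * h - overlap c d u v * q) < overlap c d u v * q.
  move=> uv mK; split; last by rewrite -ltr_pdivlMr // iou_side_den_gt0.
  (* A zero overlap would make [K u v] zero, hence at most [m]. *)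
  rewrite lt_def overlap_ge0 andbT; apply/eqP => o0.
  by move: mK; rewrite /K /iou_side o0 !mul0r ltNge m0.
case: (leP (K a1 b1) m) => [|/(gt_m _ _ ab1)[o1 k1]]; first by left.
case: (leP (K a2 b2) m) => [|/(gt_m _ _ ab2)[o2 k2]]; first by right.
have := overlap_concave t01 o1 o2; rewrite -/a -/b => cc.
(* Both ends now exceed [m]. Mixing their inequalities with weights [1 - t] and [t] gives the same
   strict inequality at the mixture, where [K] equals [m]. *)
suff: m < K a b by rewrite ltxx.
rewrite ltr_pdivlMr ?iou_side_den_gt0 //.
move: o1 o2 k1 k2 cc.
set p1 := overlap _ _ a1 b1; set p2 := overlap _ _ a2 b2.
set p := overlap _ _ a b => o1 o2 k1 k2 cc.
have cm : ((1 - t) * p1 + t * p2) * (q * (1 + m)) <= p * (q * (1 + m)).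
  by rewrite ler_wpM2r // mulr_ge0 // addr_ge0.
have e1 : 0 < p1 * q * (1 + m) - m * (G + (b1 - a1) * h) by nra.
have e2 : 0 < p2 * q * (1 + m) - m * (G + (b2 - a2) * h) by nra.
have : 0 < (1 - t) * (p1 * q * (1 + m) - m * (G + (b1 - a1) * h))
         + t * (p2 * q * (1 + m) - m * (G + (b2 - a2) * h)).
  (* Strictness needs a positive weight: that of the first end if [t = 0], otherwise that of the
     second. *)
  have [->|tn0] := eqVneq t 0; first by rewrite subr0 mul1r mul0r addr0.
  have t_gt0 : 0 < t by rewrite lt_def tn0.
  apply: ltr_wpDl; last exact: mulr_gt0.
  by apply: mulr_ge0; [rewrite subr_ge0 | exact: ltW].
rewrite /a /b; move: cm; lra.
Qed.

Lemma convex_coord (R : realType) (l x u : R) : l <= x <= u ->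
  exists2 t, 0 <= t <= 1 & x = (1 - t) * l + t * u.
Proof.
move=> /andP[lx xu]; have [lu|ul] := ltP l u; last first.
  by exists 0; [rewrite lexx ler01 | lra].
have d0 : 0 < u - l by rewrite subr_gt0.
exists ((x - l) / (u - l)); last by field; rewrite gt_eqF.
by rewrite divr_ge0 ?subr_ge0 ?(ltW lu) //= ler_pdivrMr // mul1r lerD2r.
Qed.

(** First [a] moves with [b] fixed, then [b] moves with [a'] fixed. The hypothesis [ua <= lb] keeps
    every pair met on the way ordered, as quasi-concavity requires. *)
Lemma iou_side_endpoints (R : realType) (G c d q h la ua lb ub a b : R) :
  0 < G -> 0 <= q <= h -> ua <= lb -> la <= a <= ua -> lb <= b <= ub ->
  exists a' b', [/\ a' = la \/ a' = ua, b' = lb \/ b' = ub &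
    iou_side G c d q h a' b' <= iou_side G c d q h a b].
Proof.
move=> G0 qh ualb aP bP.
have [t t01 ta] := convex_coord aP; have [s s01 sb] := convex_coord bP.
have [/andP[laa aua] /andP[lbb bub]] := (aP, bP).
have idc r x : (1 - r) * x + r * x = x :> R by ring.
have [a' a'P leK] : exists2 a', a' = la \/ a' = ua &
    iou_side G c d q h a' b <= iou_side G c d q h a b.
  have lab : la <= b by lra.
  have uab : ua <= b by lra.
  have /= := iou_side_quasiconcave c d G0 qh lab uab t01; rewrite idc -ta.
  by case=> ?; [exists la | exists ua]; auto.
have a'lb : a' <= lb by case: a'P => ->; lra.
have a'ub : a' <= ub by lra.
have /= := iou_side_quasiconcave c d G0 qh a'lb a'ub s01; rewrite idc -sb.
by case=> leb; exists a'; [exists lb | exists ub]; split; auto;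
  apply: le_trans leb leK.
Qed.

(** * Coordinates and vertices *)

Definition mkbox (R : realType) (a b c d : R) : 'rV[R]_4 := \row_(i < 4) [:: a; b; c; d]`_i.

Lemma mkboxE (R : realType) (a b c d : R) :
  ((mkbox a b c d 0 0 = a) * (mkbox a b c d 0 1 = b)
   * (mkbox a b c d 0 2 = c) * (mkbox a b c d 0 3 = d))%type.
Proof. by rewrite !mxE. Qed.

Lemma ord4P (P : 'I_4 -> Prop) : P 0 -> P 1 -> P 2 -> P 3 -> forall i, P i.
Proof.
move=> P0 P1 P2 P3 [[|[|[|[|//]]]] lt_i];
  [move: P0 | move: P1 | move: P2 | move: P3];
  by congr P; apply: val_inj.
Qed.

(** Vertices are coded by Boolean functions on ['I_4], a finite type. The coding need not be
    injective, so intervals reduced to a point do no harm. *)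
Lemma vertices_min (R : realType) (zl zu : 'rV[R]_4) (f : 'rV[R]_4 -> R) :
  exists2 v, vertices zl zu v & forall w, vertices zl zu w -> f v <= f w.
Proof.
pose vx (s : {ffun 'I_4 -> bool}) : 'rV[R]_4 :=
  \row_i if s i then zu 0 i else zl 0 i.
have [s _ smin] := @arg_minP _ _ _ [ffun=> true] xpredT (fun s => f (vx s)) isT.
exists (vx s) => [i|w Vw]; first by rewrite mxE; case: (s i); auto.
suff -> : w = vx [ffun i => w 0 i == zu 0 i] by exact: smin.
apply/rowP => i; rewrite mxE ffunE.
by case: eqP => // ne; case: (Vw i).
Qed.

(** * The IoU of boxes *)

Section Boxes.
Variables (R : realType) (g : 'rV[R]_4).
Hypotheses (g_box : is_box g) (g_area : 0 < area g).

Local Notation ovx b := (overlap (g 0 0) (g 0 2) (b 0 0) (b 0 2)).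
Local Notation ovy b := (overlap (g 0 1) (g 0 3) (b 0 1) (b 0 3)).

Lemma inter_areaE b : is_box b -> inter_area g b = ovx b * ovy b.
Proof.
case/and3P=> /forallP b0 b02 b13; have /and3P[/forallP g0 _ _] := g_box.
have i0 : inter g b 0 0 = Num.max (b 0 0) (g 0 0) by rewrite mxE.
have i1 : inter g b 0 1 = Num.max (b 0 1) (g 0 1) by rewrite mxE.
have i2 : inter g b 0 2 = Num.min (b 0 2) (g 0 2) by rewrite mxE.
have i3 : inter g b 0 3 = Num.min (b 0 3) (g 0 3) by rewrite mxE.
have ige0 : [forall i, 0 <= inter g b 0 i].
  apply/forallP => i; rewrite mxE; case: ifP => _.
    by rewrite le_max b0.
  by rewrite le_min b0 g0.
rewrite /inter_area /is_box ige0 /area i0 i1 i2 i3 /= /overlap.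
(* The corners being nonnegative, the intersection is a box exactly when both signed lengths [x] and
   [y] are nonnegative; otherwise both members vanish. *)
rewrite -subr_ge0 -[X in _ && X]subr_ge0.
set x := (_ - _); set y := (_ - _).
by case: (lerP 0 x) => x0 /=; rewrite ?mul0r //; case: (lerP 0 y); rewrite ?mulr0.
Qed.

Lemma IoU_side_x b : is_box b ->
  IoU g b = iou_side (area g) (g 0 0) (g 0 2) (ovy b) (b 0 3 - b 0 1)
              (b 0 0) (b 0 2).
Proof. by move=> bb; rewrite /IoU inter_areaE. Qed.

Lemma IoU_side_y b : is_box b ->
  IoU g b = iou_side (area g) (g 0 1) (g 0 3) (ovx b) (b 0 2 - b 0 0)
              (b 0 1) (b 0 3).
Proof.
by move=> bb; rewrite /IoU inter_areaE // /iou_side /area mulrC (mulrC (ovx b))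
  (mulrC (b 0 2 - _)) mulrC.
Qed.

Lemma IoU_ge0 b : is_box b -> 0 <= IoU g b.
Proof.
move=> bb; rewrite IoU_side_x //; have /and3P[_ b02 b13] := bb.
by apply: iou_side_ge0 => //; exact: overlap_bounds.
Qed.

Lemma IoU_flat b : is_box b -> b 0 0 = b 0 2 \/ b 0 1 = b 0 3 -> IoU g b = 0.
Proof.
have flat c d a : overlap c d a a = 0 :> R.
  by apply/eqP; rewrite eq_le overlap_ge0 -(subrr a) overlap_le.
by move=> bb; rewrite /IoU inter_areaE // => -[] ->; rewrite flat ?mulr0 ?mul0r.
Qed.

Variables zl zu : 'rV[R]_4.
Hypotheses (z_ge0 : forall i, 0 <= zl 0 i) (z_itv : forall i, zl 0 i <= zu 0 i).

Lemma IoU_vertex_le b :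
  zu 0 0 <= zl 0 2 -> zu 0 1 <= zl 0 3 -> box_range zl zu b ->
  exists2 v, vertices zl zu v & IoU g v <= IoU g b.
Proof.
move=> z02 z13 [bb bi]; have /and3P[/forallP b0 b02 b13] := bb.
have [x0 [x2 [x0P x2P lex]]] := iou_side_endpoints (g 0 0) (g 0 2)
  g_area (overlap_bounds (g 0 1) (g 0 3) b13) z02 (bi 0) (bi 2).
have u0 i : 0 <= zu 0 i by apply: le_trans (z_itv i).
have x0ge : 0 <= x0 by case: x0P => ->.
have x2ge : 0 <= x2 by case: x2P => ->.
have x02 : x0 <= x2.
  have := z_itv 0; have := z_itv 2.
  by case: x0P => ->; case: x2P => ->; lra.
(* Halfway box: its horizontal side is already at endpoints, its vertical side is still that of [b].
   The vertical pass starts from it. *)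
pose b' := mkbox x0 (b 0 1) x2 (b 0 3).
have bb' : is_box b'.
  apply/and3P; split; rewrite /b' ?mkboxE //.
  by apply/forallP; apply: ord4P; rewrite mkboxE.
have lexb : IoU g b' <= IoU g b by rewrite !IoU_side_x // !mkboxE.
have b'1 : zl 0 1 <= b' 0 1 <= zu 0 1 by rewrite mkboxE.
have b'3 : zl 0 3 <= b' 0 3 <= zu 0 3 by rewrite mkboxE.
have b'02 : b' 0 0 <= b' 0 2 by rewrite !mkboxE.
have [x1 [x3 [x1P x3P ley]]] := iou_side_endpoints (g 0 1) (g 0 3)
  g_area (overlap_bounds (g 0 0) (g 0 2) b'02) z13 b'1 b'3.
have x13 : x1 <= x3.
  have := z_itv 1; have := z_itv 3.
  by case: x1P => ->; case: x3P => ->; lra.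
exists (mkbox x0 x1 x2 x3); first by apply: ord4P; rewrite mkboxE.
apply: le_trans lexb; rewrite !IoU_side_y //; last first.
  apply/and3P; split; rewrite ?mkboxE //.
  apply/forallP; apply: ord4P; rewrite mkboxE //.
    by case: x1P => ->.
  by case: x3P => ->.
by move: ley; rewrite !mkboxE.
Qed.

Lemma flat_min :
  (exists b, box_range zl zu b /\ (b 0 0 = b 0 2 \/ b 0 1 = b 0 3)) ->
  is_min (box_range zl zu) (IoU g) 0.
Proof.
move=> [b [bP flat]]; split.
  by exists b => //; apply: IoU_flat flat; case: bP.
by move=> _ [w [wb _] <-]; exact: IoU_ge0.
Qed.

End Boxes.

Theorem mainTheorem2 (R : realType) (g zl zu : 'rV[R]_4)
  (g_box : is_box g) (g_area : 0 < area g)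
  (z_ge0 : forall i, 0 <= zl 0 i) (z_itv : forall i, zl 0 i <= zu 0 i)
  (l02 : zl 0 0 <= zl 0 2) (u02 : zu 0 0 <= zu 0 2)
  (l13 : zl 0 1 <= zl 0 3) (u13 : zu 0 1 <= zu 0 3) :
  (zl 0 2 <= zu 0 0 \/ zl 0 3 <= zu 0 1 ->
     is_min (box_range zl zu) (IoU g) 0) /\
  (~ (zl 0 2 <= zu 0 0 \/ zl 0 3 <= zu 0 1) ->
     exists m : R, is_min (vertices zl zu) (IoU g) m /\
                   is_min (box_range zl zu) (IoU g) m).
Proof.
split=> [deg|ndeg].
  apply: flat_min => //.
  (* One side collapses to the point [zl 0 2] (or [zl 0 3]), which lies in both of its coordinate
     intervals by [l02] (or [l13]); the other side takes its lower ends. *)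
  case: deg => [z20|z31]; [exists (mkbox (zl 0 2) (zl 0 1) (zl 0 2) (zl 0 3))
                          | exists (mkbox (zl 0 0) (zl 0 3) (zl 0 2) (zl 0 3))];
    rewrite !mkboxE; split; auto; split.
  - by apply/and3P; split; [apply/forallP; apply: ord4P| |]; rewrite !mkboxE.
  - by apply: ord4P; rewrite mkboxE ?lexx ?l02 ?z20 ?z_itv.
  - by apply/and3P; split; [apply/forallP; apply: ord4P| |]; rewrite !mkboxE.
  - by apply: ord4P; rewrite mkboxE ?lexx ?l13 ?z31 ?z_itv.
have z02 : zu 0 0 <= zl 0 2.
  by rewrite leNgt; apply/negP => /ltW ?; apply: ndeg; left.
have z13 : zu 0 1 <= zl 0 3.
  by rewrite leNgt; apply/negP => /ltW ?; apply: ndeg; right.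
have [v Vv vmin] := vertices_min zl zu (IoU g).
(* The best vertex serves for both minima: it lies in the range, and each box of the range has IoU
   at least that of some vertex. *)
exists (IoU g v); split; split.
- by exists v.
- by move=> _ [w Vw <-]; exact: vmin.
- exists v => //; split=> [|i].
    by apply: vertices_box ndeg _ Vv => i; rewrite z_ge0 z_itv.
  by case: (Vv i) => ->; rewrite lexx z_itv.
- move=> _ [b bP <-].
  have [w Vw] := IoU_vertex_le g_box g_area z_ge0 z_itv z02 z13 bP.
  exact/le_trans/vmin.
Qed.
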